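(* Let $d(m)$ denote the number of positive divisors of a positive integer $m$. Then, as a function of the real variable $x$, $$\sum_{n\le x}\frac{1}{d(d(n))}\asymp\frac{x}{\log\log x},$$ where the sum is over positive integers $n \le x$. That is, there exist constants $c, C>0$ and a value $x_0$ such that $c\,\frac{x}{\log\log x}\le \sum_{n\le x}\frac{1}{d(d(n))}\le C\,\frac{x}{\log\log x}$ for all real $x\ge x_0$.
   Context: For real-valued functions $f$ and $g$, $f(x)\ll g(x)$ means that there exist a constant $C>0$ and a value $x_0$ such that $|f(x)|\le C g(x)$ for all $x\ge x_0$; $f(x)\asymp g(x)$ means that both $f(x)\ll g(x)$ and $g(x)\ll f(x)$. The logarithm is the natural logarithm. *)

(* Defs.v *)
From mathcomp Require Import all_boot all_order all_algebra.
From mathcomp Require Import reals exp.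

Set Implicit Arguments.
Unset Strict Implicit.
Unset Printing Implicit Defensive.

Import Order.TTheory GRing.Theory Num.Theory.
Local Open Scope ring_scope.

(* [divisors m] is duplicate-free; it lists the divisors of [m] for [m > 0],
   the only case used. *)
Definition ndiv (m : nat) : nat := size (divisors m).

(* Vinogradov's f << g; no absolute value on the right-hand side. *)
Definition vino (R : realType) (f g : R -> R) : Prop :=
  exists C : R, exists x0 : R,
    0 < C /\ forall x : R, x0 <= x -> `|f x| <= C * g x.

Definition same_order (R : realType) (f g : R -> R) : Prop :=
  vino f g /\ vino g f.

(* For [0 <= x], [Num.truncn x] is the integer part of [x]; for [x < 0] it
   is 0 and the sum is empty, so [n] ranges over the integers 1 <= n <= x. *)
Definition sum_inv_dd (R : realType) (x : R) : R :=
  \sum_(1 <= n < (Num.truncn x).+1) ((ndiv (ndiv n))%:R)^-1.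

(* Main.v *)
Require Import Defs.
From mathcomp Require Import all_boot all_order all_algebra.
From mathcomp Require Import reals exp.
From mathcomp Require Import sequences ring lra.
Import Order.TTheory GRing.Theory Num.Theory.
Local Open Scope ring_scope.

(** Write [d] for [ndiv], [w n] for the number of prime divisors of [n], split
as [w = f + g], where [f n] counts the primes dividing [n] exactly once and
[g n] those whose square divides [n].  Put [S N = \sum_(p <= N) 1 / p].

The primes dividing [n] exactly once contribute a factor [2 ^ f n] to [d n], so
[f n + 1 <= d (d n)]; if [n] is squarefree, [d n = 2 ^ w n] and
[d (d n) = w n + 1].  Since [g] is bounded on average ([\sum_p 1 / p ^ 2] is at
most [3 / 4]), both bounds say that [d (d n)] behaves on average like [w n],
hence like [S N]:
- Outside a set of [O(N / S N)] integers, [w n] exceeds [S N / 2] by Turan's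
  variance bound ([turan]), and [g n] is less than [S N / 4] by Markov's
  inequality, so that [f n] exceeds [S N / 4].  This makes the sum of
  [1 / d (d n)] at most [19 N / S N] ([sum_inv_ndiv2_le]).
- The mean of [w] is at most [S N] and at least a quarter of the integers are
  squarefree, so convexity of [t |-> 1 / t] makes the sum at least
  [N / (16 (1 + S N))] ([sum_inv_ndiv2_ge]).

There remains to see that [S N] has the order of [ln (ln N)].  The lower bound
is Euler's comparison of the harmonic sum with a product over primes
([recip_primes_ge]).  The upper bound is Chebyshev's: the primes in
[(2 ^ k, 2 ^ k.+1]] divide a central binomial coefficient, so there are at most
[2 ^ k.+1 / k] of them, their reciprocals sum to at most [2 / k], and summing
over [k <= log_2 N] gives a harmonic sum of length [log_2 N]
([recip_primes_le]). *)

(** * The number of divisors of the number of divisors *)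

Section Arith.
Local Open Scope nat_scope.

Definition exact_primes (n : nat) : nat :=
  count (fun p => logn p n == 1) (primes n).
Definition square_primes (n : nat) : nat :=
  count (fun p => p ^ 2 %| n) (primes n).

Lemma exact_square_primes n : exact_primes n + square_primes n = size (primes n).
Proof.
rewrite -(count_predC (fun p => logn p n == 1) (primes n)); congr (_ + _).
apply: eq_in_count => p; rewrite mem_primes => /and3P[p_pr n_gt0 p_n] /=.
have v_gt0 : 0 < logn p n by rewrite logn_gt0 mem_primes p_pr n_gt0.
by rewrite pfactor_dvdn //; case: (logn p n) v_gt0 => [|[|k]].
Qed.

(** The divisors of [p * m] are those of [m] and their [p]-fold multiples, and
the two families are disjoint because [p] does not divide [m]. *)
Lemma ndiv_primeM p m : prime p -> 0 < m -> ~~ (p %| m) ->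
  ndiv (p * m) = 2 * ndiv m.
Proof.
move=> p_pr m_gt0 pNm; have p_gt0 := prime_gt0 p_pr.
have pm_gt0 : 0 < p * m by rewrite muln_gt0 p_gt0.
suff perm_div : perm_eq (divisors (p * m))
    (divisors m ++ [seq p * d | d <- divisors m]).
  by rewrite /ndiv (perm_size perm_div) size_cat size_map addnn mul2n.
apply: uniq_perm; first exact: divisors_uniq.
  rewrite cat_uniq divisors_uniq map_inj_uniq ?divisors_uniq ?andbT /=; last first.
    by move=> a b /eqP; rewrite eqn_pmul2l // => /eqP.
  apply/hasPn => _ /mapP[d _ ->]; rewrite -dvdn_divisors //=.
  by apply: contra pNm; apply: dvdn_trans; rewrite dvdn_mulr.
move=> d; rewrite mem_cat -!dvdn_divisors //; apply/idP/orP => [d_pm|].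
  have [/dvdnP[e def_d]|pNd] := boolP (p %| d); [right|left].
    apply/mapP; exists e; last by rewrite mulnC.
    by rewrite -dvdn_divisors // -(@dvdn_pmul2l p) // mulnC -def_d.
  by rewrite -(Gauss_dvdr _ (n := p)) // coprime_sym prime_coprime.
case=> [d_m|/mapP[e]]; first by rewrite dvdn_mull.
by rewrite -dvdn_divisors // => e_m ->; rewrite dvdn_pmul2l.
Qed.

(** Stripping from [n] the primes that divide it exactly once doubles the
number of divisors at each step; [m] is what is left, the part of [n] in which
every exponent is at least two. *)
Lemma ndiv_exact n : 0 < n -> exists m,
  [/\ 0 < m, m %| n, forall p, prime p -> logn p m != 1
    & ndiv n = 2 ^ exact_primes n * ndiv m].
Proof.
elim/ltn_ind: n => n IH n_gt0.
have [/hasP[p]|/hasPn no_exact] := boolP (has (fun p => logn p n == 1) (primes n)).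
  rewrite mem_primes => /and3P[p_pr _ /dvdnP[k def_n]] vpn.
  have p_gt0 := prime_gt0 p_pr; rewrite mulnC in def_n.
  rewrite {n}def_n in IH n_gt0 vpn *.
  have k_gt0 : 0 < k by move: n_gt0; rewrite muln_gt0 => /andP[].
  have vpk : logn p k = 0.
    by move: vpn; rewrite lognM // (logn_prime _ p_pr) eqxx add1n => /eqP[].
  have pNk : ~~ (p %| k).
    by apply/negP => p_k; have := logn_gt0 p k; rewrite vpk mem_primes p_pr k_gt0 p_k.
  have [|//|m [m_gt0 m_k m_exact dk]] := IH k.
    by rewrite ltn_Pmull // prime_gt1.
  exists m; split=> //; first by rewrite dvdn_mull.
  rewrite ndiv_primeM // dk mulnA -expnS; congr (2 ^ _ * _).
  have perm_pk : perm_eq (primes (p * k)) (p :: primes k).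
    apply: uniq_perm; rewrite ?primes_uniq //=.
      by rewrite mem_primes (negbTE pNk) !andbF primes_uniq.
    by move=> q; rewrite primesM // primes_prime // !inE.
  rewrite /exact_primes (permP perm_pk) /= vpn add1n; congr _.+1.
  apply: eq_in_count => q; rewrite mem_primes => /and3P[q_pr _ q_k].
  rewrite lognM // (logn_prime _ p_pr); case: (eqVneq q p) => // def_p.
  by rewrite -def_p q_k in pNk.
exists n; split=> // [p p_pr|].
  have [/no_exact //|] := boolP (p \in primes n).
  by rewrite -logn_gt0; case: (logn p n).
suff -> : exact_primes n = 0 by rewrite mul1n.
by apply/eqP; rewrite -leqn0 leqNgt -has_count; apply/hasPn.
Qed.

Lemma ndiv_gt0 n : 0 < n -> 0 < ndiv n.
Proof. by move/divisors_id; rewrite /ndiv; case: divisors. Qed.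

(** The powers [2 ^ 0, ..., 2 ^ k] are distinct divisors of [m]. *)
Lemma ndiv_pow2_dvd k m : 0 < m -> 2 ^ k %| m -> k < ndiv m.
Proof.
move=> m_gt0 k_m; rewrite /ndiv -(size_iota 0 k.+1) -(size_map (expn 2) (iota 0 k.+1)).
apply: uniq_leq_size; first by rewrite map_inj_uniq ?iota_uniq //; apply: expnI.
move=> d /mapP[i]; rewrite mem_iota add0n ltnS /= => le_ik ->.
by rewrite -dvdn_divisors //; apply: dvdn_trans k_m; apply: dvdn_exp2l.
Qed.

Lemma ndiv_pow2 k : ndiv (2 ^ k) <= k.+1.
Proof.
rewrite /ndiv -(size_iota 0 k.+1) -(size_map (expn 2) (iota 0 k.+1)).
apply: uniq_leq_size; first exact: divisors_uniq.
move=> d; rewrite -dvdn_divisors ?expn_gt0 // => /dvdn_pfactor => /(_ isT)[i le_ik ->].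
by apply/mapP; exists i; rewrite // mem_iota.
Qed.

Lemma exact_primes_lt_ndiv2 n : 0 < n -> exact_primes n < ndiv (ndiv n).
Proof.
move=> n_gt0; have [m [m_gt0 _ _ dn]] := ndiv_exact _ n_gt0.
by apply: ndiv_pow2_dvd; rewrite ?ndiv_gt0 // dn dvdn_mulr.
Qed.

(** For squarefree [n] the residual part [m] of [ndiv_exact] is 1, so [ndiv n]
is exactly a power of 2. *)
Lemma ndiv2_squarefree n : 0 < n -> square_primes n = 0 ->
  ndiv (ndiv n) <= (size (primes n)).+1.
Proof.
move=> n_gt0 sq0; have [m [m_gt0 m_n m_exact dn]] := ndiv_exact _ n_gt0.
suff m1 : m = 1.
  by rewrite -exact_square_primes sq0 addn0 dn m1 muln1; exact: ndiv_pow2.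
apply/eqP; rewrite eqn_leq m_gt0 andbT leqNgt; apply/negP => m_gt1.
pose p := pdiv m; have p_pr : prime p by apply: pdiv_prime.
have p_m : p %| m by apply: pdiv_dvd.
have v_gt0 : 0 < logn p m by rewrite logn_gt0 mem_primes p_pr m_gt0.
have /hasPn/(_ p) : ~~ has (fun p => p ^ 2 %| n) (primes n).
  by rewrite has_count -leqNgt -/(square_primes n) sq0.
rewrite mem_primes p_pr n_gt0 (dvdn_trans p_m m_n) => /(_ isT) /negP[].
apply: dvdn_trans m_n; rewrite pfactor_dvdn //.
by have := m_exact p p_pr; case: (logn p m) v_gt0 => [|[|]].
Qed.

(** The range of [p] does not depend on [n]: this is what allows exchanging a
sum over [n <= N] with the count of prime divisors. *)
Lemma count_primes (a : pred nat) n N : 0 < n <= N ->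
  count a (primes n) = \sum_(1 <= p < N.+1 | prime p) ((p %| n) && a p).
Proof.
move=> /andP[n_gt0 le_nN].
have perm_pr : perm_eq (primes n)
    [seq p <- index_iota 1 N.+1 | prime p && (p %| n)].
  apply: uniq_perm; rewrite ?primes_uniq ?filter_uniq ?iota_uniq // => p.
  rewrite mem_primes n_gt0 mem_filter mem_index_iota /= ltnS.
  case: (boolP (prime p)) => //= p_pr; case: (boolP (p %| n)) => //= p_n.
  by rewrite prime_gt0 // (leq_trans (dvdn_leq _ p_n)).
rewrite (permP perm_pr) count_filter -sum1_count big_mkcond [RHS]big_mkcond.
by apply: eq_bigr => p _ /=; rewrite andbC -andbA; case: prime => //=; case: (_ && _).
Qed.

End Arith.

(** * Averages of the number of prime divisors *)

Definition recip_primes (R : realFieldType) (N : nat) : R :=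
  \sum_(1 <= p < N.+1 | prime p) p%:R^-1.

Section Averages.
Variables (R : realFieldType).
Implicit Types (N n p q d : nat).
Local Notation S := (recip_primes R).

Lemma recip_primes_ge0 N : 0 <= S N.
Proof. by apply: sumr_ge0 => p _; rewrite invr_ge0. Qed.

Lemma sum_pred1_le p m N : \sum_(m <= q < N) (q == p)%:R <= 1 :> R.
Proof.
rewrite -natr_sum (_ : 1 = 1%:R) // ler_nat.
under eq_bigr do rewrite -[nat_of_bool _]/(if _ then 1 else 0)%N.
rewrite -big_mkcond sum1_count count_uniq_mem ?iota_uniq //; exact: leq_b1.
Qed.

Lemma sum_dvd d N :
  \sum_(1 <= n < N.+1) (d %| n)%:R = (N %/ d)%:R :> R.
Proof. by rewrite -natr_sum -divn_count_dvd. Qed.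

Lemma sum_dvd_le d N : \sum_(1 <= n < N.+1) (d %| n)%:R <= N%:R / d%:R :> R.
Proof.
rewrite sum_dvd; case: d => [|d]; first by rewrite divn0 invr0 mulr0.
by rewrite ler_pdivlMr ?ltr0n // -natrM ler_nat leq_divM.
Qed.

Lemma sum_dvd_ge d N : (0 < d)%N ->
  N%:R / d%:R - 1 <= \sum_(1 <= n < N.+1) (d %| n)%:R :> R.
Proof.
move=> d_gt0; rewrite sum_dvd lerBlDr ler_pdivrMr ?ltr0n //.
by rewrite natr1 -natrM ler_nat ltnW // ltn_ceil.
Qed.

Lemma sum_count_primes (a : nat -> pred nat) N :
  \sum_(1 <= n < N.+1) (count (a n) (primes n))%:R =
  \sum_(1 <= p < N.+1 | prime p) \sum_(1 <= n < N.+1) ((p %| n)%N && a n p)%:R :> R.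
Proof.
rewrite [RHS]exchange_big; apply: eq_big_nat => n le_nN.
by rewrite (count_primes _ _ N) // natr_sum.
Qed.

Lemma size_primesE n N : (0 < n <= N)%N ->
  (size (primes n))%:R = \sum_(1 <= p < N.+1 | prime p) (p %| n)%:R :> R.
Proof.
move=> le_nN; rewrite -(count_predT (primes n)) (count_primes _ _ N) // natr_sum.
by apply: eq_bigr => p _; rewrite andbT.
Qed.

Lemma sum_size_primes N :
  \sum_(1 <= n < N.+1) (size (primes n))%:R =
  \sum_(1 <= p < N.+1 | prime p) \sum_(1 <= n < N.+1) (p %| n)%:R :> R.
Proof.
by rewrite [RHS]exchange_big; apply: eq_big_nat => n; apply: size_primesE.
Qed.

Lemma sum_size_primes_le N :
  \sum_(1 <= n < N.+1) (size (primes n))%:R <= N%:R * S N.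
Proof.
rewrite sum_size_primes mulr_sumr; apply: ler_sum => p _; exact: sum_dvd_le.
Qed.

(** Rounding [N / p] down loses less than 1 for each of at most [N] primes. *)
Lemma sum_size_primes_ge N :
  N%:R * S N - N%:R <= \sum_(1 <= n < N.+1) (size (primes n))%:R.
Proof.
rewrite sum_size_primes mulr_sumr.
apply: (@le_trans _ _ (\sum_(1 <= p < N.+1 | prime p) (N%:R / p%:R - 1))); last first.
  apply: ler_sum => p p_pr; apply: sum_dvd_ge; exact: prime_gt0.
have card_le : \sum_(1 <= p < N.+1 | prime p) 1 <= N%:R :> R.
  have -> : N%:R = \sum_(1 <= p < N.+1) 1 :> R by rewrite sumr_const_nat subn1.
  by rewrite [leLHS]big_mkcond; apply: ler_sum => p _; case: prime.
by rewrite sumrB lerB.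
Qed.

(** For distinct primes [p] and [q], divisibility by both is divisibility by
[p * q], which bounds the count by [N / (p * q)] with no error term; the diagonal [p = q]
contributes the extra [N * S N]. *)
Lemma sum_size_primes_sqr_le N :
  \sum_(1 <= n < N.+1) (size (primes n))%:R ^+ 2 <= N%:R * S N ^+ 2 + N%:R * S N.
Proof.
have -> : \sum_(1 <= n < N.+1) (size (primes n))%:R ^+ 2 =
    \sum_(1 <= p < N.+1 | prime p) \sum_(1 <= q < N.+1 | prime q)
      \sum_(1 <= n < N.+1) ((p %| n)%N && (q %| n)%N)%:R :> R.
  under [RHS]eq_bigr do rewrite exchange_big.
  rewrite [RHS]exchange_big; apply: eq_big_nat => n le_nN.
  rewrite (size_primesE _ N) // expr2 mulr_suml; apply: eq_bigr => p _.
  by rewrite mulr_sumr; apply: eq_bigr => q _; rewrite -natrM mulnb.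
have -> : N%:R * S N ^+ 2 + N%:R * S N =
    \sum_(1 <= p < N.+1 | prime p) (N%:R / p%:R * S N + N%:R / p%:R).
  by rewrite big_split -mulr_suml -mulr_sumr expr2 mulrA.
apply: ler_sum => p p_pr.
apply: (@le_trans _ _ (\sum_(1 <= q < N.+1 | prime q)
   (N%:R / p%:R / q%:R + (q == p)%:R * (N%:R / p%:R)))).
  apply: ler_sum => q q_pr; case: (eqVneq q p) => [->|q_neq_p].
    under eq_bigr do rewrite andbb.
    rewrite mul1r; apply: le_trans (sum_dvd_le _ _) _.
    by rewrite lerDr !mulr_ge0 ?invr_ge0.
  rewrite mul0r addr0; apply: le_trans (_ : N%:R / (p * q)%:R <= _); last first.
    by rewrite natrM invfM mulrA.
  apply: le_trans (sum_dvd_le _ _); apply: ler_sum => n _.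
  by rewrite Gauss_dvd // prime_coprime // dvdn_prime2 // eq_sym.
rewrite big_split /= -mulr_sumr lerD2l -mulr_suml ler_piMl ?mulr_ge0 ?invr_ge0 //.
apply: le_trans (sum_pred1_le p 1 N.+1); rewrite [leLHS]big_mkcond.
by apply: ler_sum => q _; case: prime.
Qed.

(** Turan's inequality.  Expanding the square, the second moment and the constant
term contribute [N * S N ^+ 2] each, the cross term cancels both, and what is
left is of size [N * S N].  Rounding errors enter only through the lower bound
for the mean, so all the primes up to [N] can be kept. *)
Lemma turan N :
  \sum_(1 <= n < N.+1) ((size (primes n))%:R - S N) ^+ 2 <= 3%:R * (N%:R * S N).
Proof.
under eq_bigr do rewrite sqrrB -[_ * _ *+ 2]mulr_natl.
rewrite big_split sumrB /= sumr_const_nat subn1 -mulr_sumr -mulr_suml.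
rewrite -[_ ^+ 2 *+ _]mulr_natl /=.
have := sum_size_primes_sqr_le N; have := sum_size_primes_ge N.
have := recip_primes_ge0 N; set m1 := \sum_(_ <= _ < _) _; set m2 := \sum_(_ <= _ < _) _.
move: (S N) (N%:R : R) => s x s_ge0 le_m1 le_m2.
have : 0 <= s * (m1 - (x * s - x)) by rewrite mulr_ge0 // subr_ge0.
nra.
Qed.

(** Telescoping, from [1 / d ^ 2 <= 1 / (d - 1) - 1 / d]; keeping the term
[d = 2] apart yields [3 / 4] rather than 1, and a bound below 1 is what makes
the squarefree integers have positive density in [sum_inv_ndiv2_ge]. *)
Lemma sum_recip_sqr_le k :
  \sum_(2 <= d < k.+3) (d%:R ^+ 2)^-1 <= 3%:R / 4%:R - k.+2%:R^-1 :> R.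
Proof.
elim: k => [|k IH]; first by rewrite big_nat1; lra.
rewrite big_nat_recr //=; apply: le_trans (lerD IH (lexx _)) _.
rewrite -addrA lerD2l.
have a_gt0 : 0 < k.+2%:R :> R by rewrite ltr0n.
rewrite -[k.+3%:R]natr1; move: (k.+2%:R) a_gt0 => a a_gt0.
have b_gt0 : 0 < a + 1 by lra.
rewrite -subr_ge0 (_ : _ - _ = (a * (a + 1) ^+ 2)^-1).
  by rewrite invr_ge0 mulr_ge0 ?sqr_ge0 // ltW.
by field; rewrite !gt_eqF.
Qed.

Lemma sum_square_primes_le N :
  \sum_(1 <= n < N.+1) (square_primes n)%:R <= 3%:R / 4%:R * N%:R :> R.
Proof.
rewrite (sum_count_primes (fun n p => p ^ 2 %| n)%N).
apply: (@le_trans _ _ (\sum_(1 <= p < N.+1 | prime p) N%:R * (p%:R ^+ 2)^-1)).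
  apply: ler_sum => p _; apply: (@le_trans _ _ (\sum_(1 <= n < N.+1) (p ^ 2 %| n)%:R)).
    by apply: ler_sum => n _; case: (p %| n)%N.
  by rewrite -natrX; exact: sum_dvd_le.
rewrite -mulr_sumr mulrC ler_wpM2r //.
apply: (@le_trans _ _ (\sum_(2 <= d < N.+3) (d%:R ^+ 2)^-1)); last first.
  by apply: le_trans (sum_recip_sqr_le N) _; rewrite lerBlDr lerDl invr_ge0.
case: N => [|N]; first by rewrite big_geq // sumr_ge0 // => d _; rewrite invr_ge0 sqr_ge0.
rewrite [leLHS]big_mkcond [leLHS]big_ltn //= add0r [leRHS](big_cat_nat (n := N.+2)) //=;
  last by do 2 apply: leqW.
rewrite -[leLHS]addr0 lerD //.
  by apply: ler_sum => p _; case: prime; rewrite // invr_ge0 sqr_ge0.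
by apply: sumr_ge0 => d _; rewrite invr_ge0 sqr_ge0.
Qed.

(** With [s = S N] and the [f + g] prime divisors of [n] split as in
[exact_square_primes], one of three things happens: [f >= s / 4] and
[1 / d (d n) <= 4 / s]; or [g >= s / 4]; or [f + g <= s / 2], a large deviation
from the mean.  Adding the three corresponding bounds dominates [1 / d (d n)] by
quantities whose averages are known. *)
Lemma sum_inv_ndiv2_le N : 0 < S N ->
  \sum_(1 <= n < N.+1) (ndiv (ndiv n))%:R^-1 <= 19%:R * N%:R / S N.
Proof.
move=> S_gt0.
apply: (@le_trans _ _ (\sum_(1 <= n < N.+1)
  (4%:R / S N + 4%:R / S N ^+ 2 * ((size (primes n))%:R - S N) ^+ 2
    + 4%:R / S N * (square_primes n)%:R))).
  apply: ler_sum_nat => n /andP[n_gt0 _].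
  have := exact_primes_lt_ndiv2 _ n_gt0.
  have [] : 0 <= (exact_primes n)%:R :> R /\ 0 <= (square_primes n)%:R :> R by [].
  rewrite -exact_square_primes natrD -(ler_nat R) -[(exact_primes n).+1%:R]natr1.
  move: (ndiv _)%:R (exact_primes n)%:R (square_primes n)%:R (S N) S_gt0.
  move=> D f g s s_gt0 f_ge0 g_ge0 le_fD.
  have D_gt0 : 0 < D by lra.
  have inv_le1 : D^-1 <= 1 by rewrite invf_le1 //; lra.
  have a_ge0 : 0 <= 4%:R / s by rewrite divr_ge0 // ltW.
  have b_ge0 : 0 <= 4%:R / s ^+ 2 * (f + g - s) ^+ 2.
    by rewrite mulr_ge0 ?divr_ge0 ?sqr_ge0.
  have c_ge0 : 0 <= 4%:R / s * g by rewrite mulr_ge0.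
  have [le_f|gt_f] := leP (s / 4%:R) f.
    have : D^-1 <= 4%:R / s by rewrite ler_pdivlMr // mulrC ler_pdivrMr //; lra.
    lra.
  have [le_g|gt_g] := leP (s / 4%:R) g.
    have : 1 <= 4%:R / s * g by rewrite mulrAC ler_pdivlMr //; lra.
    lra.
  have : 1 <= 4%:R / s ^+ 2 * (f + g - s) ^+ 2.
    by rewrite mulrAC ler_pdivlMr ?exprn_gt0 //; nra.
  lra.
rewrite !big_split /= sumr_const_nat subn1 -!mulr_sumr -[_ *+ _]mulr_natr /=.
have := turan N; have := sum_square_primes_le N.
set m1 := \sum_(_ <= _ < _) _; set m2 := \sum_(_ <= _ < _) _.
move: (S N) (N%:R : R) S_gt0 => s x s_gt0 le_m1 le_m2.
apply: (@le_trans _ _ (4%:R / s * x + 4%:R / s ^+ 2 * (3%:R * (x * s))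
   + 4%:R / s * (3%:R / 4%:R * x))).
  by rewrite !lerD // ler_wpM2l // divr_ge0 ?sqr_ge0 // ltW.
rewrite le_eqVlt; apply/orP; left; apply/eqP; field; exact: lt0r_neq0.
Qed.

(** The tangent line at [T] of the convex function [t |-> 1 / t] gives
[1 / t >= 2 / T - t / T ^ 2], which is applied to [t = w n + 1] at the
squarefree [n].  The factor [1 - g n] replaces the indicator of squarefree
integers: it is 1 on them and at most 0 elsewhere.  The choice
[T = 4 * (1 + S N)] makes the main term, at least [2 / T * (N / 4)], twice the
bound [N * (1 + S N) / T ^ 2] for the other one. *)
Lemma sum_inv_ndiv2_ge N :
  N%:R / (16%:R * (1 + S N)) <= \sum_(1 <= n < N.+1) (ndiv (ndiv n))%:R^-1.
Proof.
have S_ge0 := recip_primes_ge0 N.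
have [T def_T] : {T | T = 4%:R * (1 + S N)} by exists (4%:R * (1 + S N)).
have T_gt0 : 0 < T by rewrite def_T; lra.
apply: (@le_trans _ _ (\sum_(1 <= n < N.+1)
  (2%:R / T * (1 - (square_primes n)%:R) - (T ^+ 2)^-1 * ((size (primes n))%:R + 1)))).
  rewrite sumrB -!mulr_sumr sumrB big_split /= !sumr_const_nat subn1 /=.
  have := sum_size_primes_le N; have := sum_square_primes_le N.
  set m1 := \sum_(_ <= _ < _) _; set m2 := \sum_(_ <= _ < _) _.
  move: (S N) (N%:R : R) S_ge0 def_T => s x s_ge0 def_T le_m1 le_m2.
  apply: (@le_trans _ _ (2%:R / T * (x - 3%:R / 4%:R * x) - (T ^+ 2)^-1 * (x * s + x))).
    rewrite le_eqVlt; apply/orP; left; apply/eqP; rewrite def_T; field; lra.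
  by rewrite lerB // ler_wpM2l ?lerB ?lerD // ?invr_ge0 ?divr_ge0 ?sqr_ge0 // ltW.
apply: ler_sum_nat => n /andP[n_gt0 _].
have D_gt0 : 0 < (ndiv (ndiv n))%:R :> R by rewrite ltr0n !ndiv_gt0.
have w_ge0 : 0 <= (size (primes n))%:R :> R by [].
have [sq0|] := posnP (square_primes n).
  have := ndiv2_squarefree _ n_gt0 sq0; rewrite sq0 subr0 mulr1 -(ler_nat R) -natr1.
  move: (ndiv _)%:R (size _)%:R w_ge0 D_gt0 => D w w_ge0 D_gt0 le_Dw.
  apply: (@le_trans _ _ (2%:R / T - (T ^+ 2)^-1 * D)).
    by rewrite lerB // ler_wpM2l // invr_ge0 sqr_ge0.
  rewrite -subr_ge0 (_ : _ - _ = (D - T) ^+ 2 / (D * T ^+ 2)); last first.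
    by field; rewrite !gt_eqF.
  by rewrite divr_ge0 ?sqr_ge0 // mulr_ge0 ?sqr_ge0 // ltW.
rewrite -(ler_nat R) => sq_ge1; apply: (@le_trans _ _ 0); last by rewrite invr_ge0 ltW.
rewrite subr_le0; apply: (@le_trans _ _ 0).
  by rewrite mulr_ge0_le0 ?divr_ge0 // ?subr_le0 // ltW.
by rewrite mulr_ge0 ?addr_ge0 // invr_ge0 sqr_ge0.
Qed.
End Averages.

(** * Chebyshev's bound for primes in dyadic intervals *)

Section Chebyshev.
Local Open Scope nat_scope.

Lemma prod_primes_dvd (s : seq nat) m :
  uniq s -> all prime s -> all (dvdn^~ m) s -> \prod_(p <- s) p %| m.
Proof.
elim: s => [|p s IH] /=; first by rewrite big_nil dvd1n.
move=> /andP[pNs s_uniq] /andP[p_pr s_pr] /andP[p_m s_m].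
rewrite big_cons Gauss_dvd ?p_m ?IH // big_seq.
apply: (big_ind (coprime p)) => [|a b pa pb|q q_s]; first exact: coprimen1.
  by rewrite coprimeMr pa.
rewrite prime_coprime // dvdn_prime2 //; last exact: (allP s_pr).
by apply: contraNneq pNs => ->.
Qed.

Lemma prime_ndvd_fact p n : prime p -> n < p -> ~~ (p %| n`!).
Proof.
move=> p_pr; elim: n => [|n IH] lt_np; first by rewrite dvdn1 neq_ltn prime_gt1 ?orbT.
by rewrite factS Euclid_dvdM // gtnNdvd // IH // ltnW.
Qed.

(** Such a prime divides [(2 n)!] but not [n!], hence divides the quotient
[(2 n)! / (n! * n!)]. *)
Lemma prime_dvd_central_bin p n :
  prime p -> n < p <= n + n -> p %| 'C(n + n, n).
Proof.
move=> p_pr /andP[lt_np le_p2n].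
have : p %| (n + n)`! by apply: dvdn_fact; rewrite prime_gt0.
by rewrite -(bin_fact (leq_addr n n)) addnK !Euclid_dvdM //
  (negbTE (prime_ndvd_fact _ _ p_pr lt_np)) !orbF.
Qed.

Lemma central_bin_le n : 'C(n + n, n) <= 2 ^ (n + n).
Proof.
have lt_n : n < (n + n).+1 by rewrite ltnS leq_addr.
by rewrite -[2]/(1 + 1) expnDn (bigD1 (Ordinal lt_n)) //= !exp1n !muln1 leq_addr.
Qed.

(** The product of these primes is at least [2 ^ k] to the power of their
number, and it divides the central binomial coefficient of [2 ^ k], which is at
most [2 ^ (2 ^ k.+1)]; compare exponents. *)
Lemma count_primes_dyadic k :
  k * count prime (index_iota (2 ^ k).+1 (2 ^ k.+1).+1) <= 2 ^ k.+1.
Proof.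
set s := [seq p <- index_iota (2 ^ k).+1 (2 ^ k.+1).+1 | prime p].
have mem_s p : p \in s -> prime p && (2 ^ k < p <= 2 ^ k.+1).
  by rewrite mem_filter mem_index_iota ltnS.
have dbl : 2 ^ k + 2 ^ k = 2 ^ k.+1 by rewrite addnn -mul2n expnS.
have prod_dvd : \prod_(p <- s) p %| 'C(2 ^ k + 2 ^ k, 2 ^ k).
  apply: prod_primes_dvd; rewrite ?filter_uniq ?iota_uniq ?filter_all //.
  apply/allP => p /mem_s /andP[p_pr le_p].
  by apply: prime_dvd_central_bin; rewrite // dbl.
rewrite -size_filter -/s -(leq_exp2l (m := 2)) // expnM.
rewrite -dbl; apply: leq_trans (central_bin_le _).
apply: leq_trans (dvdn_leq _ prod_dvd); last by rewrite bin_gt0 leq_addr.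
elim: (s) mem_s => [|p r IH] mem_s; first by rewrite big_nil.
rewrite big_cons expnS leq_mul ?IH //.
  by have /andP[_ /andP[/ltnW]] := mem_s p (mem_head _ _).
by move=> q q_r; apply: mem_s; rewrite inE q_r orbT.
Qed.
End Chebyshev.

(** * The order of the sum of reciprocals of primes *)

Section Mertens.
Variable R : realType.
Local Notation S := (recip_primes R).
Implicit Types (N n p q d k m : nat).

Lemma ln_le_harmonic N : ln N.+1%:R <= \sum_(1 <= n < N.+1) n%:R^-1 :> R.
Proof.
elim: N => [|N IH]; first by rewrite ln1 big_geq.
rewrite big_nat_recr //= -lerBlDl; apply: le_trans (_ : _ <= ln N.+2%:R - ln N.+1%:R) _.
  by rewrite lerD2l lerN2.
rewrite -ln_div ?posrE ?ltr0n //.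
have -> : N.+2%:R / N.+1%:R = 1 + N.+1%:R^-1 :> R.
  by rewrite -[N.+2%:R]natr1 mulrDl divff ?pnatr_eq0 // mul1r.
by apply: le_ln1Dx; rewrite (lt_le_trans (ltrN10 _)) // invr_ge0.
Qed.

Lemma harmonic_le_ln m : \sum_(1 <= n < m.+2) n%:R^-1 <= 1 + ln m.+1%:R :> R.
Proof.
elim: m => [|m IH]; first by rewrite big_nat1 ln1 invr1 addr0.
rewrite big_nat_recr //=; apply: le_trans (lerD IH (lexx _)) _.
rewrite -addrA lerD2l -lerBrDl -lerN2 opprB -ln_div ?posrE ?ltr0n //.
have -> : m.+1%:R / m.+2%:R = 1 + - m.+2%:R^-1 :> R.
  apply/(canLR (mulfK _)); first by rewrite pnatr_eq0.
  by rewrite mulrDl mul1r mulNr mulVf ?pnatr_eq0 // -[m.+2%:R]natr1 addrK.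
apply: le_ln1Dx; rewrite ltrN2 invf_lt1 ?ltr0n // ltr1n //.
Qed.

Lemma recip_primes_recr N :
  S N.+1 = S N + (if prime N.+1 then N.+1%:R^-1 else 0).
Proof. by rewrite /recip_primes big_mkcond big_nat_recr //= -big_mkcond. Qed.

(** Only an inequality, since [d * m] may exceed [N]: each multiple [n] of [d] is
matched with the single [m] such that [n = d * m]. *)
Lemma sum_multiples_le d N (F : nat -> R) : (0 < d)%N -> (forall n, 0 <= F n) ->
  \sum_(1 <= n < N.+1 | (d %| n)%N) F n <= \sum_(1 <= m < N.+1) F (d * m)%N.
Proof.
move=> d_gt0 F_ge0.
apply: (@le_trans _ _ (\sum_(1 <= n < N.+1) \sum_(1 <= m < N.+1)
    (n == (d * m)%N)%:R * F (d * m)%N)).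
  rewrite big_mkcond; apply: ler_sum_nat => n /andP[n_gt0 lt_nN].
  case: ifP => [/dvdnP[m def_n]|_]; last first.
    by apply: sumr_ge0 => m _; rewrite mulr_ge0.
  have m_in : m \in index_iota 1 N.+1.
    rewrite mem_index_iota; apply/andP; split; first by case: m def_n n_gt0 => // ->.
    by apply: leq_ltn_trans lt_nN; rewrite def_n leq_pmulr.
  rewrite (bigD1_seq m) ?iota_uniq //= mulnC -def_n eqxx mul1r lerDl.
  by apply: sumr_ge0 => i _; rewrite mulr_ge0.
rewrite exchange_big /=; apply: ler_sum => m _; rewrite -mulr_suml ler_piMl //.
exact: sum_pred1_le.
Qed.

Definition smooth k n := all (fun p => p <= k)%N (primes n).

(** Euler's product, built up by induction on [k], one prime at a time.  Let
[h k] be the left-hand side.  If [p = k.+1] is prime, the terms of [h p] with [n] prime to [p] are in [h k], and the others sum to at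
most [h p / p]; hence [(1 - 1 / p) * h p <= h k], and
[1 <= (1 - 1 / p) * (1 + 2 / p) <= (1 - 1 / p) * expR (2 / p)] as [p >= 2]. *)
Lemma euler_product_le y k :
  \sum_(1 <= n < y.+1 | smooth k n) n%:R^-1 <= expR (2%:R * S k).
Proof.
elim: k => [|k IH].
  have -> : S 0 = 0 by rewrite /recip_primes big_geq.
  rewrite mulr0 expR0.
  case: y => [|y]; first by rewrite big_geq.
  rewrite big_mkcond big_ltn //= invr1 big1_seq ?addr0 // => n /andP[_].
  rewrite mem_index_iota => /andP[n_gt1 _]; case: ifP => // /allP/(_ (pdiv n)).
  by rewrite mem_primes pdiv_prime // pdiv_dvd ltnW // leqNgt pdiv_gt0 => /(_ isT).
rewrite recip_primes_recr; have [p_pr|p_npr] := boolP (prime k.+1); last first.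
  rewrite addr0; apply: le_trans IH; rewrite le_eqVlt; apply/orP; left; apply/eqP.
  apply: eq_bigl => n; apply: eq_in_all => p; rewrite mem_primes => /andP[p_pr _].
  by rewrite leq_eqVlt ltnS; case: eqVneq p_pr => // ->; rewrite (negbTE p_npr).
pose h j : R := \sum_(1 <= n < y.+1 | smooth j n) n%:R^-1.
have h_ge0 j : 0 <= h j by apply: sumr_ge0 => n _; rewrite invr_ge0.
rewrite -/(h k) in IH; rewrite -/(h k.+1).
have p_gt0 : 0 < k.+1%:R :> R by [].
have step : h k.+1 <= h k + k.+1%:R^-1 * h k.+1.
  rewrite {1}/h (bigID (fun n => k.+1 %| n)%N) /= addrC lerD //.
    rewrite /h [leLHS]big_mkcond [leRHS]big_mkcond.
    apply: ler_sum_nat => n /andP[n_gt0 _].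
    case: ifP => [/andP[/allP le_n pNn]|_]; last by case: ifP; rewrite // invr_ge0.
    suff -> : smooth k n by [].
    apply/allP => p p_n; have := le_n p p_n; rewrite leq_eqVlt ltnS.
    case: eqVneq p_n => // ->; rewrite mem_primes => /and3P[_ _ p_n].
    by rewrite p_n in pNn.
  pose F n : R := if smooth k.+1 n then n%:R^-1 else 0.
  rewrite (eq_bigl (fun n => (k.+1 %| n)%N && smooth k.+1 n));
    last by move=> n; rewrite andbC.
  rewrite big_mkcondr -/(F _); apply: le_trans (sum_multiples_le k.+1 y F isT _) _.
    by move=> n; rewrite /F; case: ifP; rewrite // invr_ge0.
  rewrite /h mulr_sumr [leRHS]big_mkcond; apply: ler_sum_nat => m /andP[m_gt0 _].
  rewrite /F; have [sm|] := boolP (smooth k.+1 (k.+1 * m)); last first.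
    by case: ifP => // _; rewrite mulr_ge0 ?invr_ge0.
  suff -> : smooth k.+1 m by rewrite natrM invfM.
  by apply/allP => p p_m; apply: (allP sm); rewrite primesM // p_m orbT.
have p_ge2 : 2%:R <= k.+1%:R :> R by rewrite ler_nat prime_gt1.
rewrite mulrDr expRD; set E := expR (2%:R * S k) in IH *.
have := expR_ge1Dx (2%:R * k.+1%:R^-1 : R); set e := expR _ => le_e.
move: (k.+1%:R) (h k.+1) (h k) p_ge2 p_gt0 step e le_e (h_ge0 k.+1) (h_ge0 k) IH.
move=> {h_ge0} p a b p_ge2 p_gt0 step e le_e a_ge0 b_ge0 IH.
have [i_gt0 i_le] : 0 < p^-1 /\ p^-1 <= 2%:R^-1.
  by rewrite invr_gt0 lef_pV2 ?posrE.
move: (p^-1) i_gt0 i_le step le_e => i i_gt0 i_le step le_e.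
apply: (@le_trans _ _ (b * (1 + 2%:R * i))).
  apply: (@le_trans _ _ ((a * (1 - i)) * (1 + 2%:R * i))).
    have : 0 <= a * (i * (1 - 2%:R * i)) by rewrite !mulr_ge0 //; lra.
    lra.
  by rewrite ler_wpM2r; lra.
by rewrite ler_pM //; lra.
Qed.

(** All the integers up to [N] are [N]-smooth, so the harmonic sum, which is at
least [ln N.+1], is bounded by Euler's product. *)
Lemma recip_primes_ge N : ln (ln N.+1%:R) <= 2%:R * S N.
Proof.
have [le1|gt1] := leP (ln N.+1%:R : R) 1.
  by apply: le_trans (_ : _ <= 0) _; rewrite ?ln_le0 // mulr_ge0 ?recip_primes_ge0.
have ln_gt0 : 0 < ln N.+1%:R :> R by apply: lt_trans gt1.
rewrite -[leRHS]expRK ler_ln ?posrE ?expR_gt0 //.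
apply: le_trans (ln_le_harmonic N) _; apply: le_trans (euler_product_le N N).
rewrite [leRHS]big_mkcond; apply: ler_sum_nat => n /andP[n_gt0 lt_nN].
suff -> : smooth N n by [].
apply/allP => p; rewrite mem_primes => /and3P[_ _ p_n].
by apply: leq_trans (dvdn_leq _ p_n) _.
Qed.

Lemma recip_primes_mono N M : (N <= M)%N -> S N <= S M.
Proof.
move=> le_NM; rewrite /recip_primes (big_cat_nat (n := N.+1) (p := M.+1)) //=.
by rewrite lerDl sumr_ge0 // => p _; rewrite invr_ge0.
Qed.

Lemma recip_primes_dyadic k : (0 < k)%N -> S (2 ^ k.+1) <= S (2 ^ k) + 2%:R / k%:R.
Proof.
move=> k_gt0; rewrite /recip_primes.
rewrite (big_cat_nat (n := (2 ^ k).+1) (p := (2 ^ k.+1).+1)) //=.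
  rewrite lerD2l; set r := index_iota _ _.
  apply: (@le_trans _ _ (\sum_(p <- r | prime p) (2 ^ k)%N%:R^-1)).
    rewrite [leLHS]big_seq_cond [leRHS]big_seq_cond; apply: ler_sum => p /andP[].
    rewrite mem_index_iota => /andP[lt_p _] _.
    have p_gt0 : (0 < p)%N by apply: leq_ltn_trans lt_p.
    by rewrite lef_pV2 ?posrE ?ltr0n ?expn_gt0 // ler_nat ltnW.
  rewrite big_const_seq iter_addr_0 -[_ *+ count _ _]mulr_natl.
  rewrite ler_pdivrMr ?ltr0n ?expn_gt0 //.
  rewrite mulrAC ler_pdivlMr ?ltr0n // -!natrM ler_nat mulnC.
  by rewrite -expnS count_primes_dyadic.
by rewrite ltnS leq_exp2l.
Qed.

Lemma recip_primes_pow2_le k :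
  S (2 ^ k.+1) <= 2%:R^-1 + 2%:R * \sum_(1 <= n < k.+1) n%:R^-1.
Proof.
elim: k => [|k IH].
  rewrite [in leRHS]big_geq // mulr0 addr0 /recip_primes big_mkcond.
  by rewrite big_ltn // big_ltn // big_geq //= add0r addr0.
apply: le_trans (recip_primes_dyadic k.+1 isT) _.
by rewrite [in leRHS]big_nat_recr //= mulrDr addrA lerD2r.
Qed.

(** [N] lies below [2 ^ K.+1] for some [K <= log_2 N <= 2 * ln N]. *)
Lemma recip_primes_le N : (1 < N)%N ->
  S N <= 9%:R / 2%:R + 2%:R * ln (ln N%:R).
Proof.
move=> N_gt1.
have N_gt0 : (0 < N)%N by apply: ltnW.
set K := trunc_log 2 N.
have K_gt0 : (0 < K)%N by rewrite trunc_log_gt0 /=; case: (N) N_gt1.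
apply: le_trans (recip_primes_mono _ (2 ^ K.+1)%N _) _.
  by apply/ltnW/trunc_log_ltn.
apply: le_trans (recip_primes_pow2_le K) _.
have := harmonic_le_ln K.-1; rewrite prednK //.
have ln2_ge : 2%:R^-1 <= ln 2%:R :> R.
  have := @le_ln1Dx R (- 2%:R^-1); rewrite (_ : 1 - 2%:R^-1 = 2%:R^-1); last by field.
  rewrite lnV ?posrE //; lra.
have : K%:R * ln 2%:R <= ln N%:R :> R.
  rewrite mulr_natl -lnXn // ler_ln ?posrE ?exprn_gt0 ?ltr0n //.
  by rewrite -natrX ler_nat trunc_logP.
have K_gt0' : 0 < K%:R :> R by rewrite ltr0n.
move=> le_K; have : K%:R <= 2%:R * ln N%:R :> R by nra.
move=> le_K2; have lnN_gt0 : 0 < ln N%:R :> R by lra.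
have : ln K%:R <= ln 2%:R + ln (ln N%:R) :> R.
  by rewrite -lnM ?posrE // ler_ln ?posrE // mulr_gt0.
have := @le_ln1Dx R 1; rewrite (_ : 1 + 1 = 2%:R) //.
set H := \sum_(_ <= _ < _) _; lra.
Qed.
End Mertens.

(** * The order of the sum *)

Theorem theorem1 (R : realType) :
  same_order (fun x : R => sum_inv_dd x) (fun x : R => x / ln (ln x)).
Proof.
(* beyond this threshold [ln (ln x)] is at least 1, which absorbs the additive
   constants in the bounds for the sum of reciprocals of primes *)
pose x0 : R := expR (expR 1).
have large x : x0 <= x -> [/\ 3%:R <= x, 1 <= ln (ln x) & (2 < Num.truncn x)%N].
  move=> le_x; have e_ge2 : 2%:R <= expR 1 :> R.
    by have := expR_ge1Dx (1 : R); rewrite (_ : 1 + 1 = 2%:R).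
  have x_ge3 : 3%:R <= x.
    by apply: le_trans le_x; have := expR_ge1Dx (expR 1 : R); rewrite /x0; lra.
  have x_gt0 : 0 < x by lra.
  have ln_ge : expR 1 <= ln x by rewrite -[leLHS]expRK ler_ln ?posrE ?expR_gt0.
  split=> //; last by rewrite truncn_gt_nat.
  by rewrite -[leLHS]expRK ler_ln ?posrE ?expR_gt0 // (lt_le_trans _ ln_ge) ?expR_gt0.
split.
  exists 38%:R, x0; split=> // x /large[x_ge3 L_ge1 N_gt2].
  have x_gt0 : 0 < x by lra.
  have /andP[le_Nx lt_xN] := truncn_itv (ltW x_gt0).
  rewrite ger0_norm; last by apply: sumr_ge0 => n _; rewrite invr_ge0.
  rewrite /sum_inv_dd; move: (Num.truncn x) => N in N_gt2 le_Nx lt_xN *.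
  have le_L : ln (ln x) <= ln (ln N.+1%:R).
    have lnx_gt0 : 0 < ln x by apply: ln_gt0; lra.
    have le_ln : ln x <= ln N.+1%:R by rewrite ler_ln ?posrE ?ltr0n // ltW.
    by rewrite ler_ln ?posrE // (lt_le_trans lnx_gt0).
  have le_S := le_trans le_L (recip_primes_ge R N).
  have S_gt0 : 0 < recip_primes R N by lra.
  apply: le_trans (sum_inv_ndiv2_le R N S_gt0) _.
  have y_ge0 : 0 <= x / ln (ln x) by rewrite divr_ge0; lra.
  have def_x : x = x / ln (ln x) * ln (ln x) by rewrite divfK //; lra.
  rewrite ler_pdivrMr //; have := ler_wpM2l y_ge0 le_S; lra.
exists 256%:R, x0; split=> // x /large[x_ge3 L_ge1 N_gt2].
have x_gt0 : 0 < x by lra.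
have /andP[le_Nx lt_xN] := truncn_itv (ltW x_gt0).
rewrite ger0_norm; last by rewrite divr_ge0; lra.
rewrite /sum_inv_dd; move: (Num.truncn x) => N in N_gt2 le_Nx lt_xN *.
have le_L : ln (ln N%:R) <= ln (ln x).
  have N_gt0 : 0 < N%:R :> R by rewrite ltr0n ltnW // ltnW.
  have lnN_gt0 : 0 < ln N%:R :> R by rewrite ln_gt0 // ltr1n ltnW.
  have le_ln : ln N%:R <= ln x by rewrite ler_ln ?posrE.
  by rewrite ler_ln ?posrE // (lt_le_trans lnN_gt0).
have S_le := recip_primes_le R N (ltnW N_gt2).
have S_ge0 := recip_primes_ge0 R N.
have sum_ge := sum_inv_ndiv2_ge R N.
have : x / 256%:R / ln (ln x) <= N%:R / (16%:R * (1 + recip_primes R N)).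
  move: lt_xN; rewrite -natr1.
  move: (ln (ln N%:R)) (recip_primes R N) (ln (ln x)) le_L S_le S_ge0 L_ge1.
  move: (N%:R : R) => y l s L le_L S_le S_ge0 L_ge1 lt_xN.
  rewrite ler_pdivrMr; last by lra.
  rewrite mulrAC ler_pdivlMr; last by lra.
  have : x * (1 + s) <= x * (8%:R * L) by rewrite ler_wpM2l; lra.
  have : L * x <= L * (2%:R * y) by rewrite ler_wpM2l; lra.
  lra.
move=> /le_trans/(_ sum_ge); lra.
Qed.
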